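(* Let $f:V\to W$ be a linear map between finite dimensional (real or complex) vector spaces. Let $L(E,\varepsilon)$ and $L(F,\eta)$ be linear Dirac structures on $V$ and $W$, respectively. Then $$f_*\bigl(L(E,\varepsilon)\bigr)=L\bigl(f\bigl((E\cap\ker f)^{\perp_{\varepsilon}}\bigr),\check{\varepsilon}\,\bigr),\qquad f^*\bigl(L(F,\eta)\bigr)=L\bigl(f^{-1}(F),f^*(\eta)\bigr),$$ where $\check{\varepsilon}$ is the two-form on $f\bigl((E\cap\ker f)^{\perp_{\varepsilon}}\bigr)$ characterised by $f^*(\check{\varepsilon})=\varepsilon$ on $(E\cap\ker f)^{\perp_{\varepsilon}}$.
   Context: For a finite dimensional vector space $V$ (real or complex), $V\oplus V^*$ carries the nondegenerate symmetric bilinear form $\langle u+\alpha,v+\beta\rangle=\tfrac12(\alpha(v)+\beta(u))$. A linear Dirac structure on $V$ is a maximal isotropic subspace of $V\oplus V^*$. For a subspace $E\subseteq V$ and $\varepsilon\in\Lambda^2E^*$ put $L(E,\varepsilon)=\{u+\alpha\in V\oplus V^*\mid u\in E,\ \alpha|_E=\varepsilon(u,\cdot)\}$; every linear Dirac structure is of this form for a unique pair $(E,\varepsilon)$. For a subspace $A\subseteq E$, $A^{\perp_\varepsilon}=\{X\in E\mid \varepsilon(X,Y)=0\ \forall\, Y\in A\}$. For a linear map $f:V\to W$ and linear Dirac structures $L_V$, $L_W$ on $V$, $W$: $f_*(L_V)=\{f(X)+\xi\mid X\in V,\ \xi\in W^*,\ X+f^*(\xi)\in L_V\}$ (push forward)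 and $f^*(L_W)=\{X+f^*(\xi)\mid X\in V,\ \xi\in W^*,\ f(X)+\xi\in L_W\}$ (pull back), where $f^*(\xi)=\xi\circ f$. *)

(* Defs.v *)
From HB Require Import structures.
From mathcomp Require Import all_boot all_order all_algebra.

Set Implicit Arguments.
Unset Strict Implicit.
Unset Printing Implicit Defensive.

Import GRing.Theory Num.Theory.
Local Open Scope ring_scope.

Notation dual V := 'Hom(V, _^o).

(* Bilinear forms on a subspace E, curried: eps u is the functional eps(u, .). *)
Notation bilin E := 'Hom(subvs_of E, dual (subvs_of E)).

Section Dirac.

Variable K : numFieldType.
Implicit Types U V W : vectType K.

Definition alternating V (E : {vspace V}) (eps : bilin E) : Prop :=
  forall u, eps u u = 0.

(* eps(u, v) for vectors u, v of the ambient space; meaningful for u, v \in E,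
   since vsproj E is the identity on E. *)
Definition formv V (E : {vspace V}) (eps : bilin E) (u v : V) : K :=
  eps (vsproj E u) (vsproj E v).

Definition incl V (E : {vspace V}) : 'Hom(subvs_of E, V) := linfun vsval.
Definition proj V (E : {vspace V}) : 'Hom(V, subvs_of E) := linfun (vsproj E).

Definition transpose V W (f : 'Hom(V, W)) : 'Hom(dual W, dual V) :=
  linfun (fun xi : dual W => (xi \o f)%VF).

Lemma transposeE V W (f : 'Hom(V, W)) (xi : dual W) :
  transpose f xi = (xi \o f)%VF.
Proof.
have lin : linear (fun xi : dual W => (xi \o f)%VF).
  by move=> a x y; rewrite comp_lfunDl comp_lfunZl.
pose h := HB.pack_for {linear dual W -> dual V}
  (fun xi : dual W => (xi \o f)%VF) (GRing.isLinear.Build _ _ _ _ _ lin).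
exact: (lfunE h).
Qed.

Definition pairing V (x y : V * dual V) : K := 2^-1 * (x.2 y.1 + y.2 x.1).

Definition isotropic V (L : {vspace V * dual V}) : Prop :=
  forall x y, x \in L -> y \in L -> pairing x y = 0.

Definition linear_dirac V (L : {vspace V * dual V}) : Prop :=
  isotropic L /\
  forall L' : {vspace V * dual V}, isotropic L' -> (L <= L')%VS -> L' = L.

Definition dirac_of V (E : {vspace V}) (eps : bilin E) : {vspace V * dual V} :=
  (linfun fst @^-1: E :&:
   lker ((transpose (incl E) \o linfun snd) -
         (eps \o (proj E \o linfun fst)))%VF)%VS.

Lemma mem_dirac_of V (E : {vspace V}) (eps : bilin E) (u : V) (al : dual V) :
  (u, al) \in dirac_of eps <->
  u \in E /\ (forall v, v \in E -> al v = formv eps u v).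
Proof.
rewrite memv_cap -memv_preim memv_ker !lfun_simp /= transposeE subr_eq0.
split=> [/andP[Eu /eqP/lfunP h]|[-> h]].
  split=> // v Ev; have := h (vsproj E v).
  by rewrite !lfun_simp /= vsprojK.
apply/eqP/lfunP=> v; rewrite !lfun_simp /= (h _ (subvsP v)) /formv.
by rewrite vsvalK.
Qed.

(* Used only for A a subspace of E. *)
Definition perp V (E : {vspace V}) (eps : bilin E) (A : {vspace V}) :
    {vspace V} :=
  (incl E @: lker (transpose (proj E \o incl A) \o eps)%VF)%VS.

Lemma mem_perp V (E : {vspace V}) (eps : bilin E) (A : {vspace V}) (u : V) :
  u \in perp eps A <-> u \in E /\ (forall v, v \in A -> formv eps u v = 0).
Proof.
split.
  case/memv_imgP=> w; rewrite memv_ker => /eqP/lfunP h ->.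
  rewrite lfunE subvsP; split=> // v Av; have := h (vsproj A v).
  by rewrite !lfun_simp /= transposeE !lfun_simp /= vsprojK // /formv vsvalK.
case=> Eu h; apply/memv_imgP; exists (vsproj E u); last by rewrite lfunE /= vsprojK.
rewrite memv_ker; apply/eqP/lfunP=> v.
by rewrite !lfun_simp /= transposeE !lfun_simp /=; exact: h (subvsP v).
Qed.

(* f_* and f^* of subspaces are obtained from the two maps
   (X, xi) |-> (X, f^* xi) and (X, xi) |-> (f X, xi) on V (+) W^*. *)
Definition dual_leg V W (f : 'Hom(V, W)) :
    'Hom((V * dual W)%type, (V * dual V)%type) :=
  linfun (fun x : V * dual W => (x.1, transpose f x.2)).
Definition base_leg V W (f : 'Hom(V, W)) :
    'Hom((V * dual W)%type, (W * dual W)%type) :=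
  linfun (fun x : V * dual W => (f x.1, x.2)).

Definition pushforward V W (f : 'Hom(V, W)) (L : {vspace V * dual V}) :
    {vspace W * dual W} :=
  (base_leg f @: (dual_leg f @^-1: L))%VS.

Definition pullback V W (f : 'Hom(V, W)) (L : {vspace W * dual W}) :
    {vspace V * dual V} :=
  (dual_leg f @: (base_leg f @^-1: L))%VS.

Lemma dual_legE V W (f : 'Hom(V, W)) x :
  dual_leg f x = (x.1, (x.2 \o f)%VF).
Proof.
have lin : linear (fun x : V * dual W => (x.1, transpose f x.2)).
  by move=> a y z; rewrite /= linearP.
pose h := HB.pack_for {linear (V * dual W)%type -> (V * dual V)%type}
  (fun x : V * dual W => (x.1, transpose f x.2))
  (GRing.isLinear.Build _ _ _ _ _ lin).
by rewrite -transposeE; exact: (lfunE h).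
Qed.

Lemma base_legE V W (f : 'Hom(V, W)) x : base_leg f x = (f x.1, x.2).
Proof.
have lin : linear (fun x : V * dual W => (f x.1, x.2)).
  by move=> a y z; rewrite /= linearP.
pose h := HB.pack_for {linear (V * dual W)%type -> (W * dual W)%type}
  (fun x : V * dual W => (f x.1, x.2)) (GRing.isLinear.Build _ _ _ _ _ lin).
exact: (lfunE h).
Qed.

Lemma mem_pushforward V W (f : 'Hom(V, W)) L (y : W * dual W) :
  y \in pushforward f L <->
  exists X (xi : dual W), (X, (xi \o f)%VF) \in L /\ y = (f X, xi).
Proof.
split=> [/memv_imgP[[X xi]]|[X [xi [LX ->]]]].
  rewrite -memv_preim dual_legE base_legE /= => LX ->.
  by exists X, xi.
apply/memv_imgP; exists (X, xi); last by rewrite base_legE.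
by rewrite -memv_preim dual_legE.
Qed.

Lemma mem_pullback V W (f : 'Hom(V, W)) L (x : V * dual V) :
  x \in pullback f L <->
  exists X (xi : dual W), (f X, xi) \in L /\ x = (X, (xi \o f)%VF).
Proof.
split=> [/memv_imgP[[X xi]]|[X [xi [LX ->]]]].
  rewrite -memv_preim dual_legE base_legE /= => LX ->.
  by exists X, xi.
apply/memv_imgP; exists (X, xi); last by rewrite dual_legE.
by rewrite -memv_preim base_legE.
Qed.

Definition pullback_form V W (f : 'Hom(V, W)) (F : {vspace W}) (eta : bilin F) :
    bilin (f @^-1: F) :=
  let g := (proj F \o (f \o incl (f @^-1: F)))%VF in
  (transpose g \o (eta \o g))%VF.

Lemma pullback_formE V W (f : 'Hom(V, W)) (F : {vspace W}) (eta : bilin F) u v :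
  u \in (f @^-1: F)%VS -> v \in (f @^-1: F)%VS ->
  formv (pullback_form f eta) u v = formv eta (f u) (f v).
Proof.
move=> Fu Fv; rewrite /formv /pullback_form /= comp_lfunE transposeE.
by rewrite !lfun_simp /= !vsprojK.
Qed.

Lemma dirac_of_linear_dirac V (E : {vspace V}) (eps : bilin E) :
  alternating eps -> linear_dirac (dirac_of eps).
Proof.
move=> alt.
have skew u v : formv eps u v = - formv eps v u.
  apply/eqP; rewrite -addr_eq0 /formv; apply/eqP.
  have := alt (vsproj E u + vsproj E v).
  by rewrite !linearD /= !lfun_simp !alt add0r addr0 addrC.
have n2 : (2^-1 : K) != 0 by rewrite invr_eq0 pnatr_eq0.
split=> [[u al] [v be] /mem_dirac_of[/= Eu hu] /mem_dirac_of[/= Ev hv]|L' iso sub].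
  by rewrite /pairing /= hu // hv // skew addNr mulr0.
apply/eqP; rewrite eqEsubv sub andbT; apply/subvP=> -[u al] L'u.
have pair0 v be : (v, be) \in dirac_of eps -> al v + be u = 0.
  move=> /(subvP sub) /(iso _ _ L'u)/eqP; rewrite /pairing /= mulf_eq0.
  by rewrite (negbTE n2) => /eqP.
have Eu : u \in E.
  have: forall be : dual V, (forall v, v \in E -> be v = 0) -> be u = 0.
    move=> be h; have := pair0 0 be; rewrite linear0 add0r; apply.
    apply/mem_dirac_of; split=> [|v Ev]; first exact: mem0v.
    by rewrite h // /formv !linear0 zero_lfunE.
  move=> ann; pose r := (\1 - projv E)%VF.
  suff : r u = 0.
    by rewrite !lfun_simp /= => /eqP; rewrite subr_eq0 => /eqP->; exact: memv_proj.
  pose b := vbasis {:V}.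
  rewrite (coord_vbasis (memvf (r u))) big1 // => i _.
  have := ann (linfun (coord b i : V -> K^o) \o r)%VF.
  rewrite comp_lfunE lfunE /= => ->; first by rewrite scale0r.
  move=> v Ev; rewrite comp_lfunE lfunE /= !lfun_simp /= projv_id // subrr.
  by rewrite linear0.
apply/mem_dirac_of; split=> // v Ev.
pose be : dual V := (eps (vsproj E v) \o proj E)%VF.
have /pair0 : (v, be) \in dirac_of eps.
  by apply/mem_dirac_of; split=> // w _; rewrite /be !lfun_simp.
rewrite /be !lfun_simp /= => /eqP; rewrite addr_eq0 => /eqP->.
by rewrite -[eps _ _]/(formv eps v u) -skew.
Qed.

End Dirac.

(* Main.v *)
(* Where a functional must be exhibited, it is obtained by factoring a
   functional through a linear map whose kernel it annihilates.  For the pull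
   back, f^* eta - alpha is factored through the composite V -> W -> W/F, and
   this corrects an extension of eta(f X, .) to a xi with f^* xi = alpha.  For
   the push forward, write A = E /\ ker f.  Two choices of X in A^perp over
   f X differ by an element of A, so eps descends to f (A^perp).  If
   xi (f Y) = eps(X, Y) for all Y in A^perp, the functional f^* xi - eps(X, .)
   on E annihilates A^perp, which is the kernel of E -> A^*; by reflexivity
   of A it equals eps(Z, .) for some Z in A, and X + Z lies over f X. *)
Require Import Defs.
From HB Require Import structures.
From mathcomp Require Import all_boot all_order all_algebra.

Set Implicit Arguments.
Unset Strict Implicit.
Unset Printing Implicit Defensive.

Import GRing.Theory Num.Theory.
Local Open Scope ring_scope.

(** [f^-1] is only a section of [f] over its image, so [f^-1 (f u)] differs from [u] by an element
    of [lker f], which [g] kills. *)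
Lemma lfun_factor (K : fieldType) (U V T : vectType K) (f : 'Hom(U, V))
    (g : 'Hom(U, T)) :
  (lker f <= lker g)%VS -> ((g \o f^-1) \o f)%VF = g.
Proof.
move=> /subvP sub; apply/lfunP=> u; rewrite !comp_lfunE.
apply/eqP; rewrite -subr_eq0 -linearB -memv_ker; apply: sub.
by rewrite memv_ker linearB /= limg_lfunVK ?subrr // memv_img ?memvf.
Qed.

Lemma bidual_eval (K : fieldType) (A : vectType K) (ga : dual (dual A)) :
  exists z : A, forall phi : dual A, ga phi = phi z.
Proof.
pose b := vbasis {:A}.
pose c i : dual A := linfun (coord b i : A -> K^o).
(* The coordinates of the witness are the values of [ga] on the basis dual to [b]. *)
exists (\sum_(i < \dim {:A}) ga (c i) *: b`_i) => phi.
have {1}-> : phi = \sum_(i < \dim {:A}) phi b`_i *: c i.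
  apply/lfunP=> v; rewrite {1}(coord_vbasis (memvf v)) linear_sum sum_lfunE.
  apply: eq_bigr => i _.
  by rewrite linearZ scale_lfunE lfunE /= [LHS]mulrC.
rewrite !linear_sum; apply: eq_bigr => i _.
by rewrite !linearZ [LHS]mulrC.
Qed.

Section Forms.

Variables (K : numFieldType) (V W : vectType K).

Lemma formvBl (E : {vspace V}) (eps : bilin E) u u' v :
  formv eps (u - u') v = formv eps u v - formv eps u' v.
Proof. by rewrite /formv !linearB !lfun_simp. Qed.

Lemma formvBr (E : {vspace V}) (eps : bilin E) u v v' :
  formv eps u (v - v') = formv eps u v - formv eps u v'.
Proof. by rewrite /formv !linearB. Qed.

Lemma formv_skew (E : {vspace V}) (eps : bilin E) :
  alternating eps -> forall u v, formv eps u v = - formv eps v u.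
Proof.
move=> alt u v; apply/eqP; rewrite -addr_eq0 /formv; apply/eqP.
have := alt (vsproj E u + vsproj E v).
by rewrite !linearD /= !lfun_simp !alt add0r addr0 addrC.
Qed.

Lemma pullback_form_alternating (f : 'Hom(V, W)) (F : {vspace W})
    (eta : bilin F) :
  alternating eta -> alternating (pullback_form f eta).
Proof.
by move=> alt u; rewrite /pullback_form comp_lfunE transposeE !comp_lfunE alt.
Qed.

Lemma pullback_dirac_of (f : 'Hom(V, W)) (F : {vspace W}) (eta : bilin F) :
  pullback f (dirac_of eta) = dirac_of (pullback_form f eta).
Proof.
apply/vspaceP=> -[X al]; apply/idP/idP.
  move=> /mem_pullback[X' [xi [/mem_dirac_of[FX hxi] [-> ->]]]].
  have FX' : X' \in (f @^-1: F)%VS by rewrite -memv_preim.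
  apply/mem_dirac_of; split=> // v Fv.
  by rewrite comp_lfunE pullback_formE // hxi // memv_preim.
move=> /mem_dirac_of[FX hal]; apply/mem_pullback.
(* [be] extends the functional eta(f X, .) from [F] to all of [W], through the projection onto
   [F]. *)
have [be beE] : exists be : dual W, forall w, be w = formv eta (f X) w.
  by exists (eta (vsproj F (f X)) \o proj F)%VF => w; rewrite comp_lfunE lfunE.
(* [r] has kernel exactly [F] and so stands in for the quotient map W -> W/F. *)
pose r : 'Hom(W, W) := (\1 - projv F)%VF.
have rF w : (r w == 0) = (w \in F).
  rewrite /r !lfun_simp /= subr_eq0; apply/eqP/idP=> [->|Fw].
    exact: memv_proj.
  by rewrite projv_id.
pose ga : dual V := al - (be \o f)%VF.
have /lfun_factor gaE : (lker (r \o f) <= lker ga)%VS.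
  apply/subvP=> v; rewrite !memv_ker comp_lfunE rF => Fv.
  have Fv' : v \in (f @^-1: F)%VS by rewrite -memv_preim.
  by rewrite /ga !lfun_simp beE subr_eq0 hal // pullback_formE.
exists X, (be + ((ga \o (r \o f)^-1) \o r))%VF; split; last first.
  by rewrite comp_lfunDl -(comp_lfunA _ r f) gaE addrC subrK.
apply/mem_dirac_of; split=> [|w Fw]; first by rewrite memv_preim.
have /eqP rw0 : r w == 0 by rewrite rF.
by rewrite add_lfunE beE comp_lfunE rw0 linear0 addr0.
Qed.

Lemma perp_representable (E A : {vspace V}) (eps : bilin E) (al : dual V) :
  alternating eps -> (A <= E)%VS ->
  (forall Y, Y \in perp eps A -> al Y = 0) ->
  exists2 Z, Z \in A & forall v, v \in E -> al v = formv eps Z v.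
Proof.
move=> alt sAE al0.
pose g : 'Hom(subvs_of E, dual (subvs_of A)) :=
  (transpose (proj E \o incl A) \o eps)%VF.
(* [perp eps A] is by construction the image of [lker g] in [V], so [al0] gives this inclusion. *)
have /lfun_factor gE : (lker g <= lker (al \o incl E))%VS.
  apply/subvP=> u gu; rewrite memv_ker comp_lfunE; apply/eqP/al0.
  exact: memv_img.
have [z zE] := bidual_eval ((al \o incl E) \o g^-1)%VF.
(* Evaluating [g v] at [z] gives eps(v, z), with [z] in the second slot; skew symmetry accounts for
   the sign. *)
exists (- vsval z) => [|v Ev]; first by rewrite memvN subvsP.
have /(_ (vsproj E v)) := (lfunP _ _).2 gE.
rewrite comp_lfunE zE !comp_lfunE transposeE !comp_lfunE !lfunE /= vsprojK //.
move=> <-; rewrite -[LHS]/(formv eps v (vsval z)) formv_skew //.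
by rewrite -[in RHS]sub0r formvBl [X in X - _]/formv !linear0 zero_lfunE sub0r.
Qed.

Section PushForward.

Variables (f : 'Hom(V, W)) (E : {vspace V}) (eps : bilin E).
Hypothesis alt : alternating eps.

Let P := perp eps (E :&: lker f).

(** A linear choice of preimages in [P], meaningful on [f @: P] only; [perp_ker_formv] makes the
    choice immaterial for [eps]. *)
Let lift : 'Hom(W, subvs_of P) := ((f \o incl P)^-1)%VF.

Lemma img_liftK w : w \in (f @: P)%VS -> f (vsval (lift w)) = w.
Proof.
case/memv_imgP=> X PX ->.
have := @limg_lfunVK _ _ _ (f \o incl P)%VF (f X).
rewrite !comp_lfunE !lfunE /=; apply.
apply/memv_imgP; exists (vsproj P X); first exact: memvf.
by rewrite comp_lfunE lfunE /= vsprojK.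
Qed.

(** [Y - Y'] lies in [E :&: lker f], to which [P] is orthogonal; skew symmetry carries the argument
    over to the first slot. *)
Lemma perp_ker_formv X X' Y Y' :
  X \in P -> X' \in P -> Y \in P -> Y' \in P -> f X = f X' -> f Y = f Y' ->
  formv eps X Y = formv eps X' Y'.
Proof.
have kerP Z Z' T : Z \in P -> Z' \in P -> T \in P -> f Z = f Z' ->
    formv eps T Z = formv eps T Z'.
  move=> PZ PZ' /mem_perp[_ hT] fZ; apply/eqP; rewrite -subr_eq0 -formvBr.
  apply/eqP/hT; rewrite memv_cap memv_ker linearB /= fZ subrr eqxx andbT.
  by case/mem_perp: PZ PZ' => EZ _ /mem_perp[EZ' _]; rewrite memvB.
move=> PX PX' PY PY' fX fY; rewrite (kerP Y Y') // formv_skew //.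
by rewrite (kerP X X') // -formv_skew.
Qed.

Definition pushforward_form : bilin (f @: P) :=
  let g := (proj E \o (incl P \o (lift \o incl (f @: P))))%VF in
  (transpose g \o (eps \o g))%VF.

Lemma pushforward_form_alternating : alternating pushforward_form.
Proof. by move=> u; rewrite comp_lfunE transposeE !comp_lfunE alt. Qed.

Lemma pushforward_formE X Y : X \in P -> Y \in P ->
  formv pushforward_form (f X) (f Y) = formv eps X Y.
Proof.
move=> PX PY; have fPX := memv_img f PX; have fPY := memv_img f PY.
rewrite /formv /pushforward_form comp_lfunE transposeE !comp_lfunE !lfunE /=.
rewrite !vsprojK // -[LHS]/(formv eps _ _).
by apply: perp_ker_formv; rewrite ?subvsP ?img_liftK.
Qed.

Lemma pushforward_form_unique (epsc : bilin (f @: P)) :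
  (forall X Y, X \in P -> Y \in P ->
     formv epsc (f X) (f Y) = formv eps X Y) ->
  epsc = pushforward_form.
Proof.
move=> epscE; apply/lfunP=> u; apply/lfunP=> v.
have [X PX uE] := memv_imgP (subvsP u).
have [Y PY vE] := memv_imgP (subvsP v).
have := epscE X Y PX PY; rewrite -pushforward_formE // -uE -vE.
by rewrite /formv !vsvalK.
Qed.

Lemma pushforward_dirac_of :
  pushforward f (dirac_of eps) = dirac_of pushforward_form.
Proof.
apply/vspaceP=> -[w xi]; apply/idP/idP.
  move=> /mem_pushforward[X [xi' [/mem_dirac_of[EX hX] [-> ->]]]].
  (* On [E] the functional eps(X, .) agrees with [xi' \o f], which vanishes on [lker f]. *)
  have PX : X \in P.
    apply/mem_perp; split=> // v; rewrite memv_cap memv_ker => /andP[Ev /eqP fv].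
    by rewrite -hX // comp_lfunE fv linear0.
  apply/mem_dirac_of; split=> [|_ /memv_imgP[Y PY ->]]; first exact: memv_img.
  rewrite pushforward_formE // -hX ?comp_lfunE //.
  by case/mem_perp: PY.
move=> /mem_dirac_of[/memv_imgP[X PX ->] hxi]; apply/mem_pushforward.
have [EX _] := (mem_perp _ _ _).1 PX.
pose al : dual V := ((xi \o f) - (eps (vsproj E X) \o proj E))%VF.
have alE v : al v = xi (f v) - formv eps X v by rewrite !lfun_simp.
have [|Y PY|Z] := @perp_representable E (E :&: lker f) eps al alt.
- exact: capvSl.
- by rewrite alE hxi ?memv_img // pushforward_formE // subrr.
rewrite memv_cap memv_ker => /andP[EZ /eqP fZ] hZ.
exists (X + Z), xi; split; last by rewrite linearD /= fZ addr0.
apply/mem_dirac_of; split=> [|v Ev]; first exact: memvD.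
(* [X + Z] is read as [X - (0 - Z)], so that [formvBl] alone splits the form. *)
rewrite comp_lfunE -[Z]opprK formvBl -[- Z]sub0r formvBl.
rewrite -hZ // alE [X in X - (xi _ - _)]/formv !linear0 zero_lfunE sub0r opprK.
by rewrite addrC subrK.
Qed.

End PushForward.

End Forms.

Theorem proposition1p3 (K : numFieldType) (V W : vectType K) (f : 'Hom(V, W))
    (E : {vspace V}) (eps : bilin E) (F : {vspace W}) (eta : bilin F)
    (eps_alt : alternating eps) (eta_alt : alternating eta)
    (diracV : linear_dirac (dirac_of eps))
    (diracW : linear_dirac (dirac_of eta)) :
  let P := perp eps (E :&: lker f) in
  (exists epsc : bilin (f @: P),
     [/\ alternating epsc,
         (forall X Y, X \in P -> Y \in P ->
            formv epsc (f X) (f Y) = formv eps X Y),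
         (forall epsc' : bilin (f @: P), alternating epsc' ->
            (forall X Y, X \in P -> Y \in P ->
               formv epsc' (f X) (f Y) = formv eps X Y) ->
            epsc' = epsc)
       & pushforward f (dirac_of eps) = dirac_of epsc])
  /\ alternating (pullback_form f eta)
  /\ pullback f (dirac_of eta) = dirac_of (pullback_form f eta).
Proof.
move=> P; split; last first.
  by split; [exact: pullback_form_alternating | exact: pullback_dirac_of].
exists (pushforward_form f eps); split.
- exact: pushforward_form_alternating.
- exact: pushforward_formE.
- by move=> epsc' _; exact: pushforward_form_unique.
- exact: pushforward_dirac_of.
Qed.
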